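(* There is a semi-normalized unconditional basis $(x_n)_{n=1}^\infty$ of $\ell_1$, hence a basis that is equivalent to the standard unit vector basis of $\ell_1$, satisfying $$\inf_{n\in\mathbb N}\|x_n\|_{\ell_\infty}=0.$$
   Context: $\ell_1$ is the real Banach space of absolutely summable real sequences. For $x\in\ell_1$, $\|x\|_{\ell_\infty}$ denotes the supremum norm of the same sequence $x$, i.e. the norm of its image under the formal identity operator $\ell_1\to\ell_\infty$. A sequence $(x_n)$ in $\ell_1$ is semi-normalized if $0<\inf_n\|x_n\|_{\ell_1}\le\sup_n\|x_n\|_{\ell_1}<\infty$. A sequence $(x_n)$ in a Banach space $X$ is equivalent to a sequence $(y_n)$ in $X$ if there are positive numbers $K_1,K_2$ such that, for every finite sequence of scalars $(\alpha_n)_{n=1}^m$, $K_1\|\sum_{n=1}^m\alpha_n y_n\|_X\le\|\sum_{n=1}^m\alpha_nx_n\|_X\le K_2\|\sum_{n=1}^m\alpha_ny_n\|_X$. *)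

(* Defs.v *)
From HB Require Import structures.
From mathcomp Require Import all_boot all_order all_algebra.
From mathcomp Require Import mathcomp_extra boolp classical_sets functions.
From mathcomp Require Import reals ereal topology normedtype sequences.

Set Implicit Arguments.
Unset Strict Implicit.
Unset Printing Implicit Defensive.

Import Order.TTheory GRing.Theory Num.Theory.
Import numFieldNormedType.Exports.

Local Open Scope classical_set_scope.
Local Open Scope ring_scope.

Section BanachSequences.
Context {R : realType} {X : completeNormedModType R}.
Implicit Types (x y u : X ^nat) (a : R ^nat).

(* The bounds are taken in \bar R, where the supremum of an unbounded set is
   +oo (the real-valued [sup] would be 0). *)
Definition semi_normalized x : Prop :=
  (0 < ereal_inf (range (fun n => `|x n|%:E)))%E /\
  (ereal_sup (range (fun n => `|x n|%:E)) < +oo)%E.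

Definition schauder_basis x : Prop :=
  forall v : X, exists! a, [series a n *: x n]_n @ \oo --> v.

Definition unconditionally_cvg u : Prop :=
  forall s : nat -> nat, bijective s -> cvgn [series u (s n)]_n.

Definition unconditional_basis x : Prop :=
  schauder_basis x /\
  forall a, cvgn [series a n *: x n]_n ->
    unconditionally_cvg (fun n => a n *: x n).

Definition equivalent_sequences x y : Prop :=
  exists K1 K2 : R, [/\ 0 < K1, 0 < K2 &
    forall (m : nat) (a : 'I_m -> R),
      K1 * `|\sum_(n < m) a n *: y n| <= `|\sum_(n < m) a n *: x n| /\
      `|\sum_(n < m) a n *: x n| <= K2 * `|\sum_(n < m) a n *: y n| ].

End BanachSequences.

Section l1.
Context {R : realType}.

Definition abs_series (f : R ^nat) : R ^nat := series (fun n => `|f n|).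

Definition abs_summable : {pred R ^nat} :=
  fun f => `[< cvgn (abs_series f) >].

Record l1 := L1 { l1_seq :> nat -> R ; l1_seqP : l1_seq \in abs_summable }.

HB.instance Definition _ := [isSub for l1_seq].
HB.instance Definition _ := [Choice of l1 by <:].

Lemma abs_summableP (f : R ^nat) :
  reflect (cvgn (abs_series f)) (f \in abs_summable).
Proof. exact/(iffP (asboolP _)). Qed.

Lemma abs_series_ndecr (f : R ^nat) :
  nondecreasing_seq (abs_series f).
Proof. by apply: nondecreasing_series => n _ _. Qed.

Lemma abs_summable_bounded (f : R ^nat) (M : R) :
  (forall n, abs_series f n <= M) -> f \in abs_summable.
Proof.
move=> fM; apply/abs_summableP/nondecreasing_is_cvgn.
  exact: abs_series_ndecr.
by exists M => _ [n _ <-].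
Qed.

Definition l1_norm (f : R ^nat) : R := limn (abs_series f).

Lemma abs_series_le_l1_norm (f : R ^nat) n : f \in abs_summable ->
  abs_series f n <= l1_norm f.
Proof.
by move=> /abs_summableP cf; exact: (nondecreasing_cvgn_le (abs_series_ndecr f)).
Qed.

Lemma l1_norm_le (f : R ^nat) (M : R) :
  (forall n, abs_series f n <= M) -> l1_norm f <= M.
Proof.
move=> fM; apply: limr_le; first by apply/abs_summableP/(abs_summable_bounded fM).
by apply: nearW.
Qed.

Lemma coord_le_l1_norm (f : R ^nat) k : f \in abs_summable ->
  `|f k| <= l1_norm f.
Proof.
move=> fs; apply: le_trans (abs_series_le_l1_norm k.+1 fs).
by rewrite /abs_series seriesSr lerDr sumr_ge0.
Qed.

Lemma abs_seriesD (f g : R ^nat) n :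
  abs_series (f + g) n <= abs_series f n + abs_series g n.
Proof.
by rewrite /abs_series/series/= -big_split ler_sum// => i _; exact: ler_normD.
Qed.

Lemma abs_seriesZ (a : R) (f : R ^nat) n :
  abs_series (a *: f) n = `|a| * abs_series f n.
Proof.
by rewrite /abs_series/series/= mulr_sumr; apply: eq_bigr => i _; exact: normrM.
Qed.

Lemma abs_summable_submod_closed : submod_closed abs_summable.
Proof.
split.
  apply: (@abs_summable_bounded _ 0) => n.
  by rewrite /abs_series/series/= big1// => i _; rewrite normr0.
move=> a f g fs gs.
apply: (@abs_summable_bounded _ (`|a| * l1_norm f + l1_norm g)) => n.
apply: le_trans (abs_seriesD _ _ _) _.
by rewrite abs_seriesZ lerD ?ler_wpM2l ?abs_series_le_l1_norm.
Qed.

HB.instance Definition _ := GRing.isSubmodClosed.Build _ _ abs_summable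
  abs_summable_submod_closed.
HB.instance Definition _ := [SubChoice_isSubLmodule of l1 by <:].

Lemma l1_ler_normD (f g : l1) : l1_norm (f + g : l1) <= l1_norm f + l1_norm g.
Proof.
apply: l1_norm_le => n; apply: le_trans (abs_seriesD _ _ _) _.
by rewrite lerD ?abs_series_le_l1_norm ?l1_seqP.
Qed.

Lemma l1_normrZ (a : R) (f : l1) : l1_norm (a *: f : l1) = `|a| * l1_norm f.
Proof.
rewrite /l1_norm.
rewrite (_ : abs_series (a *: f : l1) = (fun n => `|a| * abs_series f n)).
  by rewrite (@limZl_tmp _ R^o)//; apply/abs_summableP/l1_seqP.
by apply/funext => n; rewrite -abs_seriesZ.
Qed.

Lemma l1_normr0_eq0 (f : l1) : l1_norm f = 0 -> f = 0.
Proof.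
move=> f0; apply/val_inj/funext => k /=; apply/eqP; rewrite -normr_le0.
by rewrite (le_trans (coord_le_l1_norm k (l1_seqP f)))// f0.
Qed.

HB.instance Definition _ := Lmodule_isNormed.Build R l1
  l1_ler_normD l1_normrZ l1_normr0_eq0.

Lemma l1_normE (f : l1) : `|f| = limn (abs_series f).
Proof. by []. Qed.

Lemma l1_complete (F : set_system l1) : ProperFilter F -> cauchy F -> cvg F.
Proof.
move=> FF /cauchy_ballP Fc.
have Fcoord k : cvg ((fun f : l1 => f k) @ F).
  apply: cauchy_cvg; apply/cauchy_ballP => e e0.
  have [[A B] /= [FA FB] AB] := Fc _ e0.
  exists ((fun f : l1 => f k) @` A, (fun f : l1 => f k) @` B) => /=.
    by split; [apply: filterS FA|apply: filterS FB] => f ?; exists f.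
  move=> [_ _] [/= [f Af <-] [g Bg <-]].
  have := AB (f, g) (conj Af Bg); rewrite -!ball_normE /ball_ /=.
  exact/le_lt_trans/(coord_le_l1_norm k (l1_seqP (f - g))).
pose g k := lim ((fun f : l1 => f k) @ F).
have tail (e : R) : 0 < e ->
    \forall f \near F, forall n, abs_series (l1_seq f - g) n <= e.
  move=> e0; have [[A B] /= [FA FB] AB] := Fc _ e0.
  apply: filterS FA => f Af n.
  have cf : abs_series (f - h) n @[h --> F] --> abs_series (l1_seq f - g) n.
    rewrite /abs_series /series /=.
    apply: (@cvg_big R nat +%R 0 xpredT); [exact: add_continuous|move=> k _].
    by apply: cvg_norm; apply: cvgB; [exact: cvg_cst|exact: Fcoord].
  apply: (cvgr_to_le cf); apply: filterS FB => h Bh.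
  have := AB (f, h) (conj Af Bh); rewrite -!ball_normE /ball_ /= => /ltW.
  exact/le_trans/(abs_series_le_l1_norm n (l1_seqP (f - h))).
have [f0 f0P] := filter_ex (tail _ ltr01).
have d0 : (f0 : R ^nat) - g \in abs_summable by exact: abs_summable_bounded f0P.
have gs : g \in abs_summable.
  by rewrite -[g](subKr (f0 : R ^nat)) rpredB// l1_seqP.
apply/cvg_ex; exists (L1 gs); apply/cvgrPdist_le => e e0.
apply: filterS (tail _ e0) => f fe; rewrite distrC.
exact: (@l1_norm_le (l1_seq f - g)).
Qed.

HB.instance Definition _ := Uniform_isComplete.Build l1 l1_complete.

Definition linfty_norm (f : R ^nat) : R := sup (range (fun n => `|f n|)).

Lemma l1_has_sup (f : l1) : has_sup (range (fun n => `|f n|)).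
Proof.
split; first by exists `|f 0%N|, 0%N.
by exists `|f| => _ [n _ <-]; apply: coord_le_l1_norm; exact: l1_seqP.
Qed.

Lemma l1_unit_subproof (n : nat) :
  (fun k => (k == n)%:R) \in abs_summable.
Proof.
apply: (@abs_summable_bounded _ 1) => m; rewrite /abs_series /series/=.
have [nm|mn] := ltnP n m.
  rewrite big_mkord (bigD1 (Ordinal nm))//= eqxx normr1 big1 ?addr0// => i.
  by rewrite -val_eqE/= => /negbTE->; rewrite normr0.
rewrite big_mkord big1// => i _.
by rewrite ltn_eqF ?normr0// (leq_trans _ mn).
Qed.

Definition l1_unit (n : nat) : l1 := L1 (l1_unit_subproof n).

End l1.
Arguments l1 R : clear implicits.

(* Main.v *)
From HB Require Import structures.
Require Import Defs.
From mathcomp Require Import all_boot all_order all_algebra.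
From mathcomp Require Import boolp classical_sets functions.
From mathcomp Require Import reals ereal topology normedtype sequences.

Set Implicit Arguments.
Unset Strict Implicit.
Unset Printing Implicit Defensive.

Import Order.TTheory GRing.Theory Num.Theory.
Import numFieldNormedType.Exports.

Local Open Scope classical_set_scope.
Local Open Scope ring_scope.

(** The basis is the image of the unit vector basis (e_n) under an isomorphism
    of l1. Cut the positive integers into the dyadic blocks
    B_k = {2 ^ k, ..., 2 ^ (k + 1) - 1}, let u_k be the average of the e_n with
    n in B_k, and put d_k = e_(2 ^ k) - u_k, a vector of norm at most 2 whose
    coordinates sum to 0. Since l1 has the universal property of a free Banach
    space on bounded families ([l1_extension]), there is a bounded operator A
    with A e_n = d_k for all n in B_k. On vectors supported in B_k it is the
    sum of the coordinates times d_k, so A d_k = 0 for all k, and A has square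
    zero ([dyadic_shear]). Hence T = id - A is an isomorphism with inverse
    id + A.

    Any isomorphism carries (e_n) to a semi-normalized unconditional basis that
    is equivalent to (e_n) ([image_semi_normalized], [image_equivalent],
    [image_unconditional_basis]). Here T e_(2 ^ k) = e_(2 ^ k) - d_k = u_k,
    whose supremum norm is at most 1 / 2 ^ k, so these norms have infimum 0. *)

(** * Coordinates and unit vectors *)

Lemma l1_unitE (R : realType) (n k : nat) : (l1_unit n : l1 R) k = (k == n)%:R.
Proof. by []. Qed.

Lemma l1_sumE (R : realType) (I : Type) (r : seq I) (P : pred I)
    (f : I -> l1 R) k :
  (\sum_(i <- r | P i) f i : l1 R) k = \sum_(i <- r | P i) f i k.
Proof. by elim/big_rec2: _ => // i y1 y2 _ <-. Qed.

Lemma l1_scaleE (R : realType) (a : R) (v : l1 R) k :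
  (a *: v : l1 R) k = a * v k.
Proof. by []. Qed.

Lemma l1_subE (R : realType) (u v : l1 R) k : (u - v : l1 R) k = u k - v k.
Proof. by []. Qed.

Lemma l1_coord_le (R : realType) (v : l1 R) k : `|v k| <= `|v|.
Proof. exact/coord_le_l1_norm/l1_seqP. Qed.

Lemma l1_unit_norm (R : realType) n : `|l1_unit n : l1 R| = 1.
Proof.
apply/eqP; rewrite eq_le; apply/andP; split; last first.
  by have := l1_coord_le (l1_unit n : l1 R) n; rewrite l1_unitE eqxx normr1.
apply: l1_norm_le => m; rewrite /abs_series /series /= big_mkord.
have [nm|mn] := ltnP n m.
  rewrite (bigD1 (Ordinal nm))//= eqxx normr1 big1 ?addr0// => i.
  by rewrite -val_eqE/= => /negbTE->; rewrite normr0.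
rewrite big1// => i _.
by rewrite ltn_eqF ?normr0// (leq_trans _ mn).
Qed.

Lemma l1_partial_sum_coord (R : realType) (a : R ^nat) m k :
  ([series a n *: (l1_unit n : l1 R)]_n m : l1 R) k = a k *+ (k < m)%N.
Proof.
rewrite /series /= l1_sumE big_mkord.
under eq_bigr do rewrite l1_scaleE l1_unitE.
have [km|mk] := ltnP k m.
  rewrite (bigD1 (Ordinal km))//= eqxx mulr1 big1 ?addr0// => i.
  by rewrite -val_eqE/= eq_sym => /negbTE->; rewrite mulr0.
rewrite big1// => i _.
by rewrite gtn_eqF ?mulr0// (leq_trans _ mk).
Qed.

Lemma l1_coord_cvg (R : realType) (u : nat -> l1 R) (v : l1 R) k :
  u @ \oo --> v -> u n k @[n --> \oo] --> v k.
Proof.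
move=> /cvgrPdist_lt uv; apply/cvgrPdist_lt => e e0.
by apply: filterS (uv e e0) => n /=; exact/le_lt_trans/(l1_coord_le (v - u n)).
Qed.

Lemma l1_unit_expansion (R : realType) (v : l1 R) :
  [series v n *: (l1_unit n : l1 R)]_n @ \oo --> v.
Proof.
have cv : abs_series v @ \oo --> `|v| by exact/abs_summableP/l1_seqP.
apply/cvgrPdist_le => e e0.
move/cvgrPdist_le: cv => /(_ e e0); apply: filterS => m.
rewrite ger0_norm ?subr_ge0 ?abs_series_le_l1_norm ?l1_seqP//; apply: le_trans.
apply: l1_norm_le => N.
have tailE k : `|(v - [series v n *: (l1_unit n : l1 R)]_n m : l1 R) k| =
    `|v k| - `|v k| *+ (k < m)%N.
  rewrite l1_subE l1_partial_sum_coord.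
  by case: ltnP => _; rewrite ?subrr ?subr0 ?normr0.
rewrite lerBrDr.
(* The tail summed up to [maxn N m], plus the first [m] terms, is a partial sum
   of the absolute series of [v]. *)
apply: le_trans (abs_series_le_l1_norm (maxn N m) (l1_seqP v)).
apply: (@le_trans _ _ (abs_series
  (v - [series v n *: (l1_unit n : l1 R)]_n m : l1 R) (maxn N m)
   + abs_series v m)).
  by rewrite lerD2r; apply: abs_series_ndecr; exact: leq_maxl.
rewrite {1 3}/abs_series /series /= (eq_bigr _ (fun k _ => tailE k)).
rewrite sumrB -lerBrDr lerD2l lerN2 /abs_series /series /= !big_mkord.
rewrite (big_ord_widen _ (fun k => `|v k|) (leq_maxr N m)) big_mkcond/=.
by apply: ler_sum => i _; rewrite mulrb.
Qed.

(** The coefficients of a convergent expansion along the unit vectors are the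
    coordinates of its sum. *)
Lemma l1_unit_coefs (R : realType) (a : R ^nat) (v : l1 R) :
  [series a n *: (l1_unit n : l1 R)]_n @ \oo --> v -> a = v.
Proof.
move=> av; apply/funext => k.
rewrite -(cvg_lim (@Rhausdorff R) (l1_coord_cvg (k := k) av)).
apply/esym/cvg_lim.
  exact: Rhausdorff.
apply: cvg_near_cst; exists k.+1 => // n /= kn.
by rewrite l1_partial_sum_coord kn.
Qed.

(** * Bounded operators on l1 *)

Lemma bounded_linear_cvg (R : realType) (V W : normedModType R)
    (T : {linear V -> W}) (K : R) (u : V ^nat) (v : V) :
  (forall w, `|T w| <= K * `|w|) -> u @ \oo --> v -> T \o u @ \oo --> T v.
Proof.
move=> TK; apply: continuous_cvg; apply: bounded_linear_continuous.
apply/linear_boundedP; near=> r => w.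
apply: le_trans (TK w) _; rewrite ler_wpM2r//.
by near: r; apply: nbhs_pinfty_ge; exact: num_real.
Unshelve. all: by end_near. Qed.

(** A bounded family of vectors is the image of the unit vectors under a
    bounded operator, namely the one that sends v to the absolutely convergent
    sum of the v n *: z n. *)
Lemma l1_extension (R : realType) (X : completeNormedModType R) (z : X ^nat)
    (K : R) : (forall n, `|z n| <= K) ->
  exists A : {linear l1 R -> X},
    (forall v, `|A v| <= K * `|v|) /\ forall n, A (l1_unit n) = z n.
Proof.
move=> zK.
have K0 : 0 <= K := le_trans (normr_ge0 _) (zK 0%N).
have term_le (v : l1 R) n : `|v n *: z n| <= K * `|v n|.
  by rewrite normrZ mulrC ler_wpM2r.
have partial_le (v : l1 R) m :
    [normed series (fun n => v n *: z n)] m <= K * `|v|.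
  apply: (@le_trans _ _ (K * abs_series v m)).
    by rewrite /abs_series /series /= mulr_sumr ler_sum.
  by rewrite ler_wpM2l// abs_series_le_l1_norm// l1_seqP.
have ncv (v : l1 R) : cvgn [normed series (fun n => v n *: z n)].
  apply: nondecreasing_is_cvgn.
    by apply: nondecreasing_series => n _ _; exact: normr_ge0.
  by exists (K * `|v|) => _ [m _ <-].
pose A (v : l1 R) : X := limn [series v n *: z n]_n.
have A_lin : linear A.
  move=> a u v; apply: cvg_lim; first exact: norm_hausdorff.
  have -> : [series (a *: u + v : l1 R) n *: z n]_n =
      a *: [series u n *: z n]_n + [series v n *: z n]_n.
    apply/funext => m.
    rewrite /series /= !fctE /= scaler_sumr -big_split.
    apply: eq_bigr => i _ /=.
    by rewrite scalerA -scalerDl.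
  by apply: cvgD; [apply: cvgZl_tmp|]; exact: (normed_cvg (ncv _)).
pose B := GRing.isLinear.Build _ _ _ _ A A_lin.
pose AL : {linear l1 R -> X} := HB.pack A B.
exists AL; split=> [v|k] /=.
  apply: le_trans (lim_series_norm (ncv v)) _; apply: limr_le => //.
  by apply: nearW => m; exact: partial_le.
apply: cvg_lim; first exact: norm_hausdorff.
apply: cvg_near_cst; exists k.+1 => // m /= km.
rewrite /series /= big_mkord (bigD1 (Ordinal km))//= eqxx scale1r big1 ?addr0//.
by move=> i; rewrite -val_eqE/= => /negbTE->; rewrite scale0r.
Qed.

(** * Images of the unit vectors under an isomorphism *)

Lemma injective_abs_summable (R : realType) (f : R ^nat) (s : nat -> nat) :
  injective s -> f \in abs_summable -> f \o s \in abs_summable.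
Proof.
move=> s_inj fs; apply: (@abs_summable_bounded _ _ (l1_norm f)) => m.
(* [N] bounds the indices [s 0], ..., [s (m - 1)]. *)
pose r := [seq s i | i <- iota 0 m]; pose N := (\max_(i <- r) i).+1.
have r_lt i : i \in r -> (i < N)%N by move=> ir; rewrite ltnS leq_bigmax_seq.
apply: le_trans (abs_series_le_l1_norm N fs).
rewrite /abs_series /series /= /index_iota !subn0.
rewrite -(big_map s xpredT (fun i => `|f i|)) -/r.
have /(perm_big _)-> : perm_eq r [seq i <- iota 0 N | i \in r].
  apply: uniq_perm => [||i].
  - by rewrite map_inj_uniq// iota_uniq.
  - by rewrite filter_uniq// iota_uniq.
  - by rewrite mem_filter mem_iota/= add0n andb_idr// => /r_lt.
rewrite big_filter big_mkcond/=; apply: ler_sum => i _; by case: ifP.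
Qed.

Section IsomorphicImage.
Context (R : realType) (T S : {linear l1 R -> l1 R}) (K : R).
Hypothesis TK : forall v, `|T v| <= K * `|v|.
Hypothesis SK : forall v, `|S v| <= K * `|v|.
Hypothesis TS : cancel T S.
Hypothesis ST : cancel S T.

Let x n := T (l1_unit n).

Let K_gt0 : 0 < K.
Proof.
have := SK (T (l1_unit 0)); rewrite TS l1_unit_norm => h.
have KT : 0 < K * `|T (l1_unit 0)| := lt_le_trans ltr01 h.
have := normr_ge0 (T (l1_unit 0)); rewrite le_eqVlt => /predU1P[T0|T_gt0].
  by move: KT; rewrite -T0 mulr0 ltxx.
by rewrite -(pmulr_lgt0 _ T_gt0).
Qed.

Lemma image_semi_normalized : semi_normalized x.
Proof.
split.
  apply: (@lt_le_trans _ _ (K^-1)%:E); first by rewrite lte_fin invr_gt0.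
  apply: le_ereal_inf_tmp => _ [n _ <-]; rewrite lee_fin.
  rewrite -[leLHS]mulr1 ler_pdivrMl//.
  by have := SK (x n); rewrite TS l1_unit_norm.
apply: (@le_lt_trans _ _ K%:E); last exact: ltry.
apply: ge_ereal_sup => _ [n _ <-]; rewrite lee_fin.
by have := TK (l1_unit n); rewrite l1_unit_norm mulr1.
Qed.

Lemma image_equivalent : equivalent_sequences x l1_unit.
Proof.
exists K^-1, K; split; rewrite ?invr_gt0// => m a.
have -> : \sum_(n < m) a n *: x n = T (\sum_(n < m) a n *: l1_unit n).
  by rewrite linear_sum; apply: eq_bigr => i _; rewrite linearZ.
by split=> //; rewrite ler_pdivrMl// -{1}(TS (\sum_(n < m) _)).
Qed.

Lemma image_series (a : R ^nat) :
  T \o [series a n *: l1_unit n]_n = [series a n *: x n]_n.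
Proof.
apply/funext => m; rewrite /series /= linear_sum.
by apply: eq_bigr => i _; rewrite linearZ.
Qed.

Lemma image_coefs (a : R ^nat) (v : l1 R) :
  [series a n *: x n]_n @ \oo --> v -> a = S v.
Proof.
move=> /(bounded_linear_cvg SK) av; apply: l1_unit_coefs.
suff -> : [series a n *: (l1_unit n : l1 R)]_n = S \o [series a n *: x n]_n.
  exact: av.
by rewrite -image_series; apply/funext => m /=; rewrite TS.
Qed.

(** Unconditionality holds because the coefficients of a convergent expansion
    are the coordinates of a vector of l1: every rearrangement of the expansion
    converges absolutely. *)
Lemma image_unconditional_basis : unconditional_basis x.
Proof.
split=> [v|a /cvg_ex[v /image_coefs aE] s /bij_inj s_inj].
  exists (S v); split=> [|b /image_coefs->//].
  rewrite -image_series -{2}(ST v).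
  exact/(bounded_linear_cvg TK)/l1_unit_expansion.
have /abs_summableP as_cvg : a \o s \in abs_summable.
  by apply: injective_abs_summable => //; rewrite aE l1_seqP.
apply: normed_cvg.
apply: (@series_le_cvg _ _ (fun n => K * `|a (s n)|)) => [n|n|n|] /=.
- exact: normr_ge0.
- by rewrite mulr_ge0 ?normr_ge0 ?ltW.
- rewrite normrZ mulrC ler_wpM2r//.
  by have := TK (l1_unit (s n)); rewrite l1_unit_norm mulr1.
- have -> : series (fun n => K * `|a (s n)|) = K *: abs_series (a \o s).
    by apply/funext => m; rewrite /series /= fctE /= -mulr_sumr.
  exact: is_cvgZl_tmp.
Qed.

End IsomorphicImage.

(** * Averaging over dyadic blocks *)

(** The average of the unit vectors with index in the dyadic block
    {2 ^ k, ..., 2 ^ (k + 1) - 1}. *)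
Definition dyadic_average (R : realType) (k : nat) : l1 R :=
  (2 ^ k)%:R^-1 *: \sum_(i < 2 ^ k) l1_unit (2 ^ k + i).

Lemma dyadic_average_coord (R : realType) k n :
  dyadic_average R k n = (2 ^ k)%:R^-1 *+ (2 ^ k <= n < 2 ^ k.+1)%N.
Proof.
rewrite l1_scaleE l1_sumE -[RHS]mulr_natr; congr (_ * _).
under eq_bigr do rewrite l1_unitE.
have [kn|nk] /= := leqP (2 ^ k) n; last first.
  rewrite big1// => i _.
  by rewrite ltn_eqF// (leq_trans nk) ?leq_addr.
have [nk|kn'] := ltnP n (2 ^ k.+1).
  have nk' : (n - 2 ^ k < 2 ^ k)%N by rewrite ltn_subLR// addnn -mul2n -expnS.
  rewrite (bigD1 (Ordinal nk'))//= subnKC// eqxx big1 ?addr0// => i.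
  rewrite -val_eqE /= => ik; rewrite -(subnKC kn) eqn_add2l.
  by rewrite eq_sym (negbTE ik).
rewrite big1// => i _; rewrite gtn_eqF//.
by rewrite (leq_trans _ kn')// expnS mul2n -addnn ltn_add2l.
Qed.

Lemma dyadic_average_norm (R : realType) k : `|dyadic_average R k| <= 1.
Proof.
rewrite normrZ ger0_norm ?invr_ge0// ler_pdivrMl ?ltr0n ?expn_gt0//.
rewrite mulr1; apply: le_trans (ler_norm_sum _ _ _) _.
rewrite (eq_bigr (fun=> 1)) => [|i _]; last exact: l1_unit_norm.
by rewrite sumr_const card_ord.
Qed.

Lemma linfty_norm_ge0 (R : realType) (v : l1 R) : 0 <= linfty_norm v.
Proof.
apply: le_trans (ub_le_sup (proj2 (l1_has_sup v)) _); last by exists 0%N.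
exact: normr_ge0.
Qed.

Lemma dyadic_average_linfty_norm (R : realType) k :
  linfty_norm (dyadic_average R k) <= (2 ^ k)%:R^-1.
Proof.
apply: ge_sup; first by case: (l1_has_sup (dyadic_average R k)).
move=> _ [n _ <-]; rewrite dyadic_average_coord normrMn ger0_norm ?invr_ge0//.
by rewrite mulrb; case: ifP; rewrite ?invr_ge0.
Qed.

(** The operator sends all the unit vectors of one dyadic block to the same
    vector, and therefore kills the difference between any of them and their
    average; its values are limits of combinations of such differences. *)
Lemma dyadic_shear (R : realType) :
  exists A : {linear l1 R -> l1 R},
    [/\ forall v, `|A v| <= 2 * `|v|,
        forall v, A (A v) = 0 &
        forall k, A (l1_unit (2 ^ k)) = l1_unit (2 ^ k) - dyadic_average R k].
Proof.
(* [trunc_log 2 n] is the index of the block of [n]; [trunc_log 2 0] is the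
   default [0], which is harmless since [d 0] vanishes. *)
pose d k : l1 R := l1_unit (2 ^ k) - dyadic_average R k.
have [n|A [A2 Ae]] := @l1_extension R _ (fun n => d (trunc_log 2 n)) 2.
  apply: le_trans (ler_normB _ _) _; rewrite l1_unit_norm.
  by rewrite -[leRHS]/(1 + 1) lerD2l dyadic_average_norm.
have Ablock k i : (i < 2 ^ k)%N -> A (l1_unit (2 ^ k + i)) = d k.
  move=> ik; rewrite Ae (@trunc_log_eq 2 k)// leq_addr/=.
  by rewrite expnS mul2n -addnn ltn_add2l.
have Astart k : A (l1_unit (2 ^ k)) = d k.
  by rewrite -[(2 ^ k)%N]addn0 Ablock// expn_gt0.
exists A; split=> // v.
have Ad k : A (d k) = 0.
  rewrite linearB /= Astart linearZ /= linear_sum /=.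
  rewrite (eq_bigr (fun=> d k)) => [|i _]; last exact: Ablock.
  rewrite sumr_const card_ord -(scaler_nat _ (d k)) scalerA.
  by rewrite mulVf ?scale1r ?subrr// pnatr_eq0 expn_eq0.
(* [A] vanishes on its values at the unit vectors, hence on its range, by
   continuity. *)
have := bounded_linear_cvg A2 (bounded_linear_cvg A2 (@l1_unit_expansion R v)).
move/cvg_lim => <-; last exact: norm_hausdorff.
apply: cvg_lim; first exact: norm_hausdorff.
apply: cvg_near_cst; apply: nearW => m /=.
rewrite /series /= !linear_sum big1// => i _.
by rewrite !linearZ /= Ae Ad scaler0.
Qed.

Theorem proposition1 (R : realType) :
  exists x : nat -> l1 R,
    [/\ semi_normalized x,
        unconditional_basis x,
        equivalent_sequences x l1_unit &
        ereal_inf (range (fun n => (linfty_norm (x n))%:E)) = 0%E].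
Proof.
have [A [A2 AA Ae]] := dyadic_shear R.
pose T : {linear l1 R -> l1 R} := idfun \- A.
pose S : {linear l1 R -> l1 R} := idfun \+ A.
have T3 v : `|T v| <= 3 * `|v|.
  apply: le_trans (ler_normB _ _) _.
  by rewrite -[3]/(1 + 2) mulrDl mul1r lerD2l.
have S3 v : `|S v| <= 3 * `|v|.
  apply: le_trans (ler_normD _ _) _.
  by rewrite -[3]/(1 + 2) mulrDl mul1r lerD2l.
have TS : cancel T S.
  by move=> v; rewrite /S /T /= linearB /= AA subr0 subrK.
have ST : cancel S T.
  by move=> v; rewrite /S /T /= linearD /= AA addr0 addrK.
exists (fun n => T (l1_unit n)); split.
- exact: image_semi_normalized T3 S3 TS.
- exact: image_unconditional_basis T3 S3 TS ST.
- exact: image_equivalent T3 S3 TS.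
have Tstart k : T (l1_unit (2 ^ k)) = dyadic_average R k.
  by rewrite /T /= Ae subKr.
apply/eqP; rewrite eq_le; apply/andP; split; last first.
  apply: le_ereal_inf_tmp => _ [n _ <-].
  by rewrite lee_fin linfty_norm_ge0.
apply/lee_addgt0Pr => e e0; rewrite add0e.
have [k ke] : exists k, (2 ^ k)%:R^-1 <= e.
  exists (Num.bound e^-1).
  rewrite -[leRHS]invrK lef_pV2 ?posrE ?invr_gt0 ?ltr0n ?expn_gt0//.
  apply/ltW/(lt_trans (archi_boundP _)); first by rewrite invr_ge0 ltW.
  by rewrite ltr_nat ltn_expl.
apply: ge_ereal_inf; exists (linfty_norm (dyadic_average R k))%:E.
  by exists (2 ^ k)%N => //; rewrite Tstart.
by rewrite lee_fin (le_trans _ ke)// dyadic_average_linfty_norm.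
Qed.
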